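(* Let $G$ be a finite graph and $n$ a positive integer, and for each $k$ let $\mathcal P_k$ be the set of all profiles of clique separations of $G$ of order $k$. Then there is a nested set $N$ of separations of $G$ which efficiently distinguishes all the distinguishable profiles in $\bigcup_{i=1}^n\mathcal P_i$; that is, for any two distinguishable profiles $P,P'$ in this union, $N$ contains a clique separation which distinguishes $P$ and $P'$ efficiently.
   Context: A separation of $G=(V,E)$ is a pair $(A,B)$ with $A\cup B=V$ and no edge between $A\setminus B$ and $B\setminus A$; its inverse is $(B,A)$, its order is $|A\cap B|$, and $(A,B)\le(C,D)$ iff $A\subseteq C$, $B\supseteq D$; meet is $(A\cap C,B\cup D)$. Two separations are nested if they have comparable orientations; a set is nested if its elements are pairwise nested. A clique separation is one with $G[A\cap B]$ complete; $S_k$ is the set of clique separations of order $<k$. A profile of order $k$ is a set $P$ containing exactly one orientation of each element of $S_k$, which is consistent (no $\vec r,\vec s\in P$ with $\overleftarrow r<\vec s$) and satisfies: for all $\vec r,\vec s\in P$, $\overleftarrow r\wedge\overleftarrow s\notin P$. A clique separation distinguishes two profiles if they contain different orientations of it, and distinguishes them efficiently if it is of minimal order among all clique separations distinguishing them; two profiles are distinguishable if some clique separation distinguishes them. *)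

(* Defs.v *)
(* A finite simple graph is a symmetric irreflexive relation on a finType. *)
From mathcomp Require Import all_boot.

Set Implicit Arguments.
Unset Strict Implicit.
Unset Printing Implicit Defensive.

(* A term of type [sep V] is an oriented separation once [separation e] holds;
   the unoriented separation underlying [s] is represented by either of the
   members of [orientations s]. *)
Definition sep (V : finType) : finType := ({set V} * {set V})%type.

Definition separation (V : finType) (e : rel V) (s : sep V) : bool :=
  (s.1 :|: s.2 == [set: V]) &&
  [forall x in s.1 :\: s.2, forall y in s.2 :\: s.1, ~~ e x y].

Definition sep_inv (V : finType) (s : sep V) : sep V := (s.2, s.1).

Definition orientations (V : finType) (s : sep V) : {set sep V} :=
  [set s; sep_inv s].

Definition sep_order (V : finType) (s : sep V) : nat := #|s.1 :&: s.2|.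

Definition sep_le (V : finType) (r s : sep V) : bool :=
  (r.1 \subset s.1) && (s.2 \subset r.2).

Definition sep_lt (V : finType) (r s : sep V) : bool :=
  (r != s) && sep_le r s.

Definition sep_meet (V : finType) (r s : sep V) : sep V :=
  (r.1 :&: s.1, r.2 :|: s.2).

Definition nested (V : finType) (r s : sep V) : bool :=
  [exists r' in orientations r, exists s' in orientations s,
     sep_le r' s' || sep_le s' r'].

Definition nested_set (V : finType) (N : {set sep V}) : bool :=
  [forall r in N, forall s in N, nested r s].

Definition clique (V : finType) (e : rel V) (K : {set V}) : bool :=
  [forall x in K, forall y in K, (x != y) ==> e x y].

Definition clique_sep (V : finType) (e : rel V) (s : sep V) : bool :=
  separation e s && clique e (s.1 :&: s.2).

(* The set S_k, given by all orientations of its elements. *)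
Definition clique_seps (V : finType) (e : rel V) (k : nat) : {set sep V} :=
  [set s | clique_sep e s & sep_order s < k].

(* Counting orientations, rather than asking for [s] or [sep_inv s] exclusively,
   also covers the degenerate case [sep_inv s = s]. *)
Definition orients (V : finType) (P S : {set sep V}) : bool :=
  (P \subset S) && [forall s in S, #|P :&: orientations s| == 1].

(* [r = s] is allowed, so [P] contains no [s] with [sep_inv s] strictly below
   [s]. *)
Definition consistent (V : finType) (P : {set sep V}) : bool :=
  [forall r in P, forall s in P, ~~ sep_lt (sep_inv r) s].

Definition profile (V : finType) (e : rel V) (k : nat) (P : {set sep V}) :
    bool :=
  [&& orients P (clique_seps e k), consistent P &
      [forall r in P, forall s in P,
         sep_meet (sep_inv r) (sep_inv s) \notin P]].

Definition profiles (V : finType) (e : rel V) (k : nat) : {set {set sep V}} :=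
  [set P | profile e k P].

Definition distinguishes (V : finType) (e : rel V) (s : sep V)
    (P P' : {set sep V}) : bool :=
  clique_sep e s &&
  [exists r in P :&: orientations s, exists t in P' :&: orientations s, r != t].

Definition distinguishable (V : finType) (e : rel V) (P P' : {set sep V}) :
    bool :=
  [exists s, distinguishes e s P P'].

Definition efficiently_distinguishes (V : finType) (e : rel V) (s : sep V)
    (P P' : {set sep V}) : bool :=
  distinguishes e s P P' &&
  [forall t, distinguishes e t P P' ==> (sep_order s <= sep_order t)].

(* Main.v *)
(* Starting from the empty set, extend for each k = 0, 1, ... the nested
   set of clique separations of order < k already found to a maximal nested set
   N of clique separations of order <= k.  Suppose t, of order k, distinguishes
   Q and Q' efficiently and crosses as few elements of N as possible.  If s in N
   crosses t, then either s itself distinguishes Q and Q', or both contain the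
   same orientation of s, say s.  Since the separator of s is a clique, it lies
   on one side of t, so that t \/ s or t^-1 \/ s has its separator inside that
   of t; this corner distinguishes Q and Q' by the profile property, and crosses
   fewer elements of N than t does.  If t crosses no element of N, it belongs to
   N by maximality. *)
Require Import Defs.
From mathcomp Require Import all_boot.

Set Implicit Arguments.
Unset Strict Implicit.
Unset Printing Implicit Defensive.

(** * Order, joins and nestedness of separations *)

Definition sep_join (V : finType) (r s : sep V) : sep V :=
  (r.1 :|: s.1, r.2 :&: s.2).

Lemma sep_invK (V : finType) : involutive (@sep_inv V).
Proof. by case. Qed.

Lemma sep_order_inv (V : finType) (s : sep V) :
  sep_order (sep_inv s) = sep_order s.
Proof. by rewrite /sep_order /= setIC. Qed.

Lemma sep_le_inv (V : finType) (r s : sep V) :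
  sep_le (sep_inv r) (sep_inv s) = sep_le s r.
Proof. by rewrite /sep_le /= andbC. Qed.

Lemma sep_le_invl (V : finType) (r s : sep V) :
  sep_le (sep_inv r) s = sep_le (sep_inv s) r.
Proof. by rewrite -sep_le_inv sep_invK. Qed.

Lemma sep_le_invr (V : finType) (r s : sep V) :
  sep_le r (sep_inv s) = sep_le s (sep_inv r).
Proof. by rewrite -sep_le_inv sep_invK. Qed.

Lemma sep_le_trans (V : finType) : transitive (@sep_le V).
Proof.
move=> s r t /andP[rs1 sr2] /andP[st1 ts2].
by rewrite /sep_le (subset_trans rs1) ?(subset_trans ts2).
Qed.

Lemma sep_le_joinl (V : finType) (r s : sep V) : sep_le r (sep_join r s).
Proof. by rewrite /sep_le /= subsetUl subsetIl. Qed.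

Lemma sep_le_joinr (V : finType) (r s : sep V) : sep_le s (sep_join r s).
Proof. by rewrite /sep_le /= subsetUr subsetIr. Qed.

Lemma sep_join_le (V : finType) (r s t : sep V) :
  sep_le (sep_join r s) t = sep_le r t && sep_le s t.
Proof. by rewrite /sep_le /= subUset subsetI andbACA. Qed.

(** Through this identity the profile condition reads: for [r], [s] in [P], the inverse of their
    join is not in [P]. *)
Lemma sep_inv_join (V : finType) (r s : sep V) :
  sep_inv (sep_join r s) = sep_meet (sep_inv r) (sep_inv s).
Proof. by []. Qed.

Lemma orientationsP (V : finType) (r s : sep V) :
  reflect (r = s \/ r = sep_inv s) (r \in orientations s).
Proof. by rewrite !inE; apply: (iffP orP) => -[]/eqP; auto. Qed.

Lemma orientations_inv (V : finType) (r s : sep V) :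
  r \in orientations s -> sep_inv r \in orientations s.
Proof.
by case/orientationsP=> ->; apply/orientationsP; rewrite ?sep_invK; auto.
Qed.

(** Inversion reverses the order, so the eight comparisons between orientations coincide in pairs,
    and inverting [r] alone is enough. *)
Lemma nestedE (V : finType) (r s : sep V) :
  nested r s = [|| sep_le r s, sep_le (sep_inv r) s, sep_le s r
                 | sep_le s (sep_inv r)].
Proof.
apply/exists_inP/idP.
  case=> r' /orientationsP[]-> /exists_inP[s' /orientationsP[]-> /orP[]];
    rewrite ?sep_le_inv ?(sep_le_invl s) ?(sep_le_invr r) => ->;
    by rewrite ?orbT.
by case/or4P=> h;
  [exists r | exists (sep_inv r) | exists r | exists (sep_inv r)];
  rewrite ?inE ?eqxx ?orbT //; apply/exists_inP; exists s;
  rewrite ?inE ?eqxx ?h ?orbT.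
Qed.

Lemma nested_refl (V : finType) : reflexive (@nested V).
Proof. by move=> s; rewrite nestedE /sep_le !subxx. Qed.

Lemma nested_sym (V : finType) : symmetric (@nested V).
Proof.
move=> r s; rewrite !nestedE (sep_le_invl s) (sep_le_invr r).
by do 4?case: (sep_le _ _).
Qed.

Lemma nested_invr (V : finType) (r s : sep V) :
  nested r (sep_inv s) = nested r s.
Proof.
rewrite !nestedE !sep_le_inv (sep_le_invl s) (sep_le_invr r).
by do 4?case: (sep_le _ _).
Qed.

Lemma nested_orientations (V : finType) (r s t : sep V) :
  t \in orientations s -> nested r t = nested r s.
Proof. by case/orientationsP=> ->; rewrite ?nested_invr. Qed.

(* If s <= r <= t^-1 then s and t are nested, so for crossing s and t an
   orientation of r that lies above s and one that lies above t must agree. *)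
Lemma nested_join (V : finType) (r s t : sep V) :
  ~~ nested s t -> nested r s -> nested r t -> nested r (sep_join t s).
Proof.
move=> crossing; rewrite !nestedE !sep_join_le => nested_rs nested_rt.
have le_s x : sep_le x s -> sep_le x (sep_join t s).
  by move=> /sep_le_trans; apply; apply: sep_le_joinr.
have le_t x : sep_le x t -> sep_le x (sep_join t s).
  by move=> /sep_le_trans; apply; apply: sep_le_joinl.
have cross_r x : sep_le s x -> sep_le t (sep_inv x) -> False.
  rewrite sep_le_invr => sx /(sep_le_trans sx) h; move: crossing.
  by rewrite nested_sym nestedE h !orbT.
case/or4P: nested_rs => [/le_s->|/le_s->|sr|sr]; rewrite ?orbT //;
case/or4P: nested_rt => [/le_t->|/le_t->|tr|tr]; rewrite ?orbT ?sr ?tr ?orbT //.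
- by case: (cross_r r).
- by case: (cross_r (sep_inv r)); rewrite ?sep_invK.
Qed.

(** * Clique separations and their corners *)

Section CliqueSeparations.

Context {V : finType} {e : rel V} (e_sym : symmetric e).

Lemma separationP (s : sep V) :
  reflect ((forall x, (x \in s.1) || (x \in s.2)) /\
           forall x y, x \in s.1 -> x \notin s.2 -> y \in s.2 ->
             y \notin s.1 -> ~~ e x y)
          (separation e s).
Proof.
apply: (iffP andP) => [[/eqP cover /forall_inP noedge]|[cover noedge]]; split.
- by move=> x; rewrite -in_setU cover inE.
- move=> x y x1 x2 y2 y1.
  have /forall_inP : [forall y in s.2 :\: s.1, ~~ e x y].
    by apply: noedge; rewrite inE x2.
  by apply; rewrite inE y1.
- by apply/eqP/setP=> x; rewrite !inE cover.
- apply/forall_inP=> x /setDP[x1 x2]; apply/forall_inP=> y /setDP[y2 y1].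
  exact: noedge.
Qed.

Lemma cliqueP (K : {set V}) :
  reflect {in K &, forall x y, x != y -> e x y} (clique e K).
Proof.
apply: (iffP forall_inP) => [h x y xK yK neq_xy | h x xK].
  by move/forall_inP: (h x xK) => /(_ y yK); rewrite neq_xy.
by apply/forall_inP=> y yK; apply/implyP; apply: h.
Qed.

Lemma sub_clique (K L : {set V}) : K \subset L -> clique e L -> clique e K.
Proof.
move=> /subsetP subKL /cliqueP cliqueL; apply/cliqueP=> x y /subKL xL /subKL yL.
exact: cliqueL.
Qed.

Lemma separation_inv (s : sep V) : separation e s -> separation e (sep_inv s).
Proof.
case/separationP=> cover noedge; apply/separationP; split=> [x | x y] /=.
  by rewrite orbC.
by move=> x2 x1 y1 y2; rewrite e_sym; apply: noedge.
Qed.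

Lemma clique_sep_inv (s : sep V) : clique_sep e s -> clique_sep e (sep_inv s).
Proof. by case/andP=> ? ?; rewrite /clique_sep separation_inv //= setIC. Qed.

Lemma clique_sep_orientations (s t : sep V) :
  t \in orientations s -> clique_sep e s -> clique_sep e t.
Proof. by case/orientationsP=> -> //; apply: clique_sep_inv. Qed.

Lemma sep_order_orientations (s t : sep V) :
  t \in orientations s -> sep_order t = sep_order s.
Proof. by case/orientationsP=> -> //; apply: sep_order_inv. Qed.

Lemma separation_join (r s : sep V) :
  separation e r -> separation e s -> separation e (sep_join r s).
Proof.
move=> /separationP[coverr noedger] /separationP[covers noedges].
apply/separationP; split=> [x | x y] /=; rewrite !inE.
  by move: (coverr x) (covers x); do 4?case: (x \in _).
(* [y] lies strictly on the second side of both separations, and [x] strictly on the first side of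
   at least one, which then forbids the edge. *)
move=> _ /nandP[xr2|xs2] /andP[yr2 ys2]; rewrite negb_or => /andP[yr1 ys1].
  by apply: noedger => //; have := coverr x; rewrite (negbTE xr2) orbF.
by apply: noedges => //; have := covers x; rewrite (negbTE xs2) orbF.
Qed.

(** Otherwise [K] has a vertex outside [s.1] and one outside [s.2]; they are non-adjacent, being
    strictly on opposite sides, yet distinct members of a clique. *)
Lemma clique_side (s : sep V) (K : {set V}) :
  separation e s -> clique e K -> (K \subset s.1) || (K \subset s.2).
Proof.
move=> /separationP[cover noedge] /cliqueP cliqueK; apply/norP.
case=> /subsetPn[y yK ys1] /subsetPn[x xK xs2].
have xs1 : x \in s.1 by move: (cover x); rewrite (negbTE xs2) orbF.
have ys2 : y \in s.2 by move: (cover y); rewrite (negbTE ys1).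
have /negP[] := noedge x y xs1 xs2 ys2 ys1.
by apply: cliqueK => //; apply: contraNneq ys1 => <-.
Qed.

(** A vertex that the separator of the join receives from [s.1] lies in the separator of [s], hence
    in [t.1]. So this separator is contained in that of [t] and inherits both completeness and the
    order bound. *)
Lemma clique_sep_join (s t : sep V) :
  clique_sep e s -> clique_sep e t -> s.1 :&: s.2 \subset t.1 ->
  clique_sep e (sep_join t s) /\ sep_order (sep_join t s) <= sep_order t.
Proof.
case/andP=> sep_s _ /andP[sep_t clique_t] /subsetP sub_t1.
have sub : (sep_join t s).1 :&: (sep_join t s).2 \subset t.1 :&: t.2.
  apply/subsetP=> x /=; rewrite !inE => /andP[t1s1 /andP[t2 s2]].
  rewrite t2 andbT; case/orP: t1s1 => // s1.
  by apply: sub_t1; rewrite inE s1.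
split; last exact: subset_leq_card.
by rewrite /clique_sep separation_join //= (sub_clique sub).
Qed.

(** * Profiles, distinguishing separations and uncrossing *)

Lemma orientsP (P : {set sep V}) (k : nat) :
  orients P (clique_seps e k) ->
  (forall s, s \in P -> clique_sep e s /\ sep_order s < k) /\
  (forall s, clique_sep e s -> sep_order s < k ->
     exists2 u, u \in orientations s & u \in P).
Proof.
case/andP=> /subsetP sub /forall_inP unique; split=> s.
  by move=> /sub; rewrite inE => /andP.
move=> clique_s order_s.
have /cards1P[u eq_u] : #|P :&: orientations s| == 1.
  by apply: unique; rewrite inE clique_s.
have : u \in P :&: orientations s by rewrite eq_u inE.
by rewrite inE => /andP[? ?]; exists u.
Qed.

Lemma profileP (P : {set sep V}) (k : nat) : profile e k P ->
  [/\ orients P (clique_seps e k),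
      {in P &, forall r s, ~~ sep_lt (sep_inv r) s} &
      {in P &, forall r s, sep_meet (sep_inv r) (sep_inv s) \notin P}].
Proof.
case/and3P=> orientsP /forall_inP consP /forall_inP meetP; split=> // r s rP.
  by move: s; apply/forall_inP; apply: consP.
by move: s; apply/forall_inP; apply: meetP.
Qed.

(** Two different orientations of [s] are inverse to each other, so a single [u] records both
    choices. *)
Lemma distinguishesP (s : sep V) (P P' : {set sep V}) :
  reflect (clique_sep e s /\ exists u,
             [/\ u \in orientations s, u \in P, sep_inv u \in P' &
                 u != sep_inv u])
          (distinguishes e s P P').
Proof.
apply: (iffP andP) => -[clique_s h]; split=> //.
  case/exists_inP: h => r /setIP[rP rs] /exists_inP[t /setIP[tP' ts] neq_rt].
  have eq_t : t = sep_inv r.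
    case/orientationsP: rs ts neq_rt => -> /orientationsP[]->;
      by rewrite ?eqxx ?sep_invK.
  by exists r; rewrite -eq_t.
case: h => u [us uP uP' neq_u].
apply/exists_inP; exists u; first by rewrite inE uP.
apply/exists_inP; exists (sep_inv u) => //.
by rewrite inE uP' orientations_inv.
Qed.

Lemma distinguishesC (s : sep V) (P P' : {set sep V}) :
  distinguishes e s P P' = distinguishes e s P' P.
Proof.
congr (_ && _); apply/exists_inP/exists_inP=> -[r rP /exists_inP[t tP neq]];
by exists t => //; apply/exists_inP; exists r; rewrite // eq_sym.
Qed.

(** The order bound forces both profiles to orient the join. [P] contains the join itself by the
    profile condition; [P'] contains its inverse, since [sep_inv t] in [P'] and a separation
    strictly above [t] would be inconsistent. *)
Lemma distinguishes_join {i j : nat} {P P' : {set sep V}} {s t : sep V} :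
  profile e i P -> profile e j P' ->
  s \in P -> t \in P -> sep_inv t \in P' -> ~~ nested s t ->
  clique_sep e (sep_join t s) -> sep_order (sep_join t s) <= sep_order t ->
  distinguishes e (sep_join t s) P P'.
Proof.
move=> /profileP[/orientsP[memP orientP] _ meetP].
move=> /profileP[/orientsP[memP' orientP'] consP' _].
move=> sP tP tP' crossing clique_c le_c.
have notinP : sep_inv (sep_join t s) \notin P.
  by rewrite sep_inv_join; apply: meetP.
have cP : sep_join t s \in P.
  have [_ order_t] := memP t tP.
  have [u + uP] := orientP _ clique_c (leq_ltn_trans le_c order_t).
  by case/orientationsP=> [<- //|eq_u]; rewrite -eq_u uP in notinP.
have cP' : sep_inv (sep_join t s) \in P'.
  have [_ order_t] := memP' _ tP'.
  rewrite sep_order_inv in order_t.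
  have [u + uP'] := orientP' _ clique_c (leq_ltn_trans le_c order_t).
  case/orientationsP=> eq_u; last by rewrite -eq_u.
  case/negP: (consP' _ _ tP' uP'); rewrite sep_invK eq_u.
  rewrite /sep_lt sep_le_joinl andbT.
  (* The join is strictly above [t]: equality would give [s] below [t], so the two would be
     nested. *)
  apply: contraNneq crossing => eq_t.
  by rewrite nestedE eq_t sep_le_joinr.
apply/distinguishesP; split=> //; exists (sep_join t s); split=> //.
  by rewrite !inE eqxx.
by apply: contraNneq notinP => <-.
Qed.

Lemma uncross {i j : nat} {P P' : {set sep V}} {s t : sep V} :
  profile e i P -> profile e j P' ->
  efficiently_distinguishes e t P P' -> clique_sep e s ->
  sep_order s <= sep_order t -> ~~ nested s t ->
  distinguishes e s P P' \/
  exists c, [/\ efficiently_distinguishes e c P P', nested s c &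
    forall r, nested r s -> nested r t -> nested r c].
Proof.
move=> profP profP' /andP[/distinguishesP[clique_t [u [ut uP uP' _]]]].
move=> /forallP min_t clique_s le_st crossing.
have /profileP[/orientsP[memP orientP] _ _] := profP.
have /profileP[/orientsP[memP' orientP'] _ _] := profP'.
have order_u := sep_order_orientations ut.
(* Both profiles orient [t], so its order is below [i] and [j]; hence they orient [s] as well. *)
have lt_si : sep_order s < i.
  by have [_] := memP u uP; rewrite order_u; apply: leq_ltn_trans.
have lt_sj : sep_order s < j.
  have [_] := memP' _ uP'; rewrite sep_order_inv order_u.
  exact: leq_ltn_trans.
have [v vs vP] := orientP s clique_s lt_si.
have [w ws wP'] := orientP' s clique_s lt_sj.
have [eq_vw|neq_vw] := eqVneq v w; last first.
  left; apply/andP; split=> //; apply/exists_inP.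
  exists v; first by rewrite inE vP.
  by apply/exists_inP; exists w; rewrite // inE wP'.
rewrite -{w ws}eq_vw in wP'; right.
have clique_u := clique_sep_orientations ut clique_t.
have clique_v := clique_sep_orientations vs clique_s.
have crossing_uv : ~~ nested v u.
  by rewrite (nested_orientations _ ut) nested_sym (nested_orientations _ vs)
    nested_sym.
(* A corner of order at most that of [t] is again efficient; it lies above [v], hence is nested with
   [s], and [nested_join] handles every other [r]. *)
have corner x : x \in orientations t -> ~~ nested v x ->
    distinguishes e (sep_join x v) P P' ->
    sep_order (sep_join x v) <= sep_order x ->
    exists c, [/\ efficiently_distinguishes e c P P', nested s c &
      forall r, nested r s -> nested r t -> nested r c].
  move=> xt crossing_x dist_c le_c; exists (sep_join x v); split.
  - rewrite /efficiently_distinguishes dist_c.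
    apply/forallP=> y; apply/implyP=> dist_y.
    apply: leq_trans le_c _; rewrite (sep_order_orientations xt).
    exact: (implyP (min_t y)).
  - rewrite nested_sym -(nested_orientations _ vs) nestedE sep_le_joinr.
    by rewrite !orbT.
  - move=> r rs rt; apply: nested_join => //.
      by rewrite (nested_orientations _ vs).
    by rewrite (nested_orientations _ xt).
(* The side of [u] containing the clique separator of [v] decides which orientation of [t] is joined
   with [v]. *)
have /orP[side|side] :=
  clique_side (proj1 (andP clique_u)) (proj2 (andP clique_v)).
  have [clique_c le_c] := clique_sep_join clique_v clique_u side.
  apply: (corner u) => //.
  exact: (distinguishes_join profP profP').
have crossing_v : ~~ nested v (sep_inv u) by rewrite nested_invr.
have [clique_c le_c] := clique_sep_join clique_v (clique_sep_inv clique_u) side.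
apply: (corner (sep_inv u)) => //.
  exact: orientations_inv.
(* The profiles swap roles, because [sep_inv u] belongs to [P'] and [u] to [P], while both contain
   [v]. *)
rewrite distinguishesC; apply: (distinguishes_join profP' profP) => //.
by rewrite sep_invK.
Qed.

(** * Maximal nested sets and the induction on the order *)

Definition nested_clique_seps (k : nat) (N : {set sep V}) : bool :=
  (N \subset clique_seps e k) && nested_set N.

Lemma nested_setP (N : {set sep V}) :
  reflect {in N &, forall r s, nested r s} (nested_set N).
Proof.
apply: (iffP forall_inP) => [h r s rN | h r rN].
  by move: s; apply/forall_inP; apply: h.
by apply/forall_inP=> s; apply: h.
Qed.

(** [N] is chosen before the profiles and their orders, so one set serves all pairs; the induction
    is on the bound for the order of [t]. *)
Lemma nested_efficient (k : nat) : exists N, nested_clique_seps k N /\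
  forall i j P P' t, profile e i P -> profile e j P' ->
    efficiently_distinguishes e t P P' -> sep_order t < k ->
    exists2 s, s \in N & efficiently_distinguishes e s P P'.
Proof.
elim: k => [|k [N0 [/andP[sub0 nested0] effN0]]].
  exists set0; split=> //; rewrite /nested_clique_seps sub0set /=.
  by apply/nested_setP=> r s; rewrite inE.
have nestedN0 : nested_clique_seps k.+1 N0.
  rewrite /nested_clique_seps nested0 andbT; apply/subsetP=> s /(subsetP sub0).
  by rewrite !inE => /andP[-> /ltnW].
have [N /maxsetP[/andP[subN nestedN] maxN] subN0] := maxset_exists nestedN0.
exists N; split=> [|i j P P' t0 profP profP' eff0]; first exact/andP.
rewrite ltnS leq_eqVlt => /predU1P[eq_k|lt_k]; last first.
  have [s sN0 eff_s] := effN0 _ _ _ _ _ profP profP' eff0 lt_k.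
  by exists s => //; apply: (subsetP subN0).
pose crossed t := [set r in N | ~~ nested r t].
have [t eff_t min_t] := @arg_minnP _ t0
  (fun t => efficiently_distinguishes e t P P') (fun t => #|crossed t|) eff0.
(* [t] and [t0] are both efficient for the same pair, so their orders agree. *)
have order_t : sep_order t = k.
  move: eff0 eff_t => /andP[dist0 /forallP min0] /andP[dist_t /forallP mint].
  apply/eqP; rewrite -eq_k eqn_leq (implyP (min0 t)) //.
  by rewrite (implyP (mint t0)).
have [/eqP cross0|[s]] := set_0Vmem (crossed t).
  exists t => //.
  have nested_t r : r \in N -> nested r t.
    move=> rN; apply: contraT => crossing.
    move: cross0; rewrite -subset0 => /subsetP/(_ r).
    by rewrite !inE rN crossing => /(_ isT).
  (* Maximality puts [t] into [N] once [t |: N] is shown to be a nested set of clique separations of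
     order at most [k]. *)
  rewrite -(maxN (t |: N)) ?subsetUr ?setU11 //; apply/andP; split.
    rewrite subUset subN sub1set inE order_t ltnSn !andbT.
    by case/andP: eff_t => /andP[].
  apply/nested_setP=> r s /setU1P[->|rN] /setU1P[->|sN].
  - exact: nested_refl.
  - by rewrite nested_sym nested_t.
  - exact: nested_t.
  - exact: (nested_setP _ nestedN).
rewrite inE => /andP[sN crossing].
have /[!inE] /andP[clique_s order_s] := subsetP subN s sN.
rewrite ltnS -order_t in order_s.
have [dist_s|[c [eff_c nested_sc nested_c]]] :=
  uncross profP profP' eff_t clique_s order_s crossing.
  exists s => //; rewrite /efficiently_distinguishes dist_s.
  apply/forallP=> y; apply/implyP=> dist_y; apply: leq_trans order_s _.
  by case/andP: eff_t => _ /forallP /(_ y) /implyP; apply.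
(* Elements of [N] are nested with [s], so those nested with [t] are nested with [c]; [s] itself
   crosses [t] but not [c], against the choice of [t]. *)
have := min_t c eff_c; rewrite leqNgt => /negP[]; apply: proper_card.
apply/properP; split.
  apply/subsetP=> r; rewrite !inE => /andP[rN]; rewrite rN; apply: contra.
  by apply: nested_c; apply: (nested_setP _ nestedN).
by exists s; rewrite !inE sN // nested_sc.
Qed.

End CliqueSeparations.

Theorem theorem14 (V : finType) (e : rel V)
    (e_sym : symmetric e) (e_irr : irreflexive e) (n : nat) (n_gt0 : 0 < n) :
  exists N : {set sep V},
    [/\ forall s : sep V, s \in N -> separation e s,
        nested_set N &
        forall P P' : {set sep V},
          P \in \bigcup_(1 <= i < n.+1) profiles e i ->
          P' \in \bigcup_(1 <= i < n.+1) profiles e i ->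
          distinguishable e P P' ->
          exists2 s : sep V, s \in N & efficiently_distinguishes e s P P'].
Proof.
(* No separator has more than [#|V|] vertices, so this bound admits every separation. *)
have [N [/andP[subN nestedN] effN]] := nested_efficient e_sym #|V|.+1.
exists N; split=> // [s /(subsetP subN)|P P' profP profP'].
  by rewrite inE => /andP[/andP[]].
have profile_of Q : Q \in \bigcup_(1 <= i < n.+1) profiles e i ->
    exists i, profile e i Q.
  elim/big_rec: _ => [|i A _ IH]; rewrite inE // inE => /orP[|/IH//].
  by exists i.
have [[i profi] [j profj]] := (profile_of P profP, profile_of P' profP').
case/existsP=> t0 dist0.
(* A distinguishing separation of least order is an efficient one. *)
have [t dist_t min_t] := @arg_minnP _ t0
  (fun t => distinguishes e t P P') (@sep_order V) dist0.
apply: (effN i j P P' t) => //; last by rewrite ltnS max_card.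
rewrite /efficiently_distinguishes dist_t; apply/forallP=> y; apply/implyP.
exact: min_t.
Qed.
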